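(* Let $\alpha,\beta,\gamma$ be real numbers with $\beta\neq 0$. If $\alpha$ is the arithmetic mean of $\beta$ and $\gamma$ (that is, $2\alpha=\beta+\gamma$), and $\beta$ is the geometric mean of $\alpha$ and $\gamma$ (in the sense that $\beta^2=\alpha\gamma$), then $\gamma$ is the harmonic mean of $\alpha$ and $\beta$, that is, $$\frac{2}{\gamma}=\frac1\alpha+\frac1\beta .$$
   Context: The condition $\beta\ne0$ together with $\beta^2=\alpha\gamma$ forces $\alpha$ and $\gamma$ to be nonzero, so all the fractions are defined. The harmonic mean of nonzero reals $x,y$ is $\frac{2}{\frac1x+\frac1y}$. *)

(* Defs.v *)
From Stdlib Require Import Reals.
Open Scope R_scope.

(* Meaningful only when x, y and /x + /y are nonzero. *)
Definition harmonic_mean (x y : R) : R := 2 / (1 / x + 1 / y).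

(* Main.v *)
Require Import Defs.
From Stdlib Require Import Reals.
Open Scope R_scope.

(** Multiplying the arithmetic-mean relation by [beta] and replacing [beta ^ 2]
    by [alpha * gamma] gives [2 * alpha * beta = gamma * (alpha + beta)]; dividing
    by [alpha * beta * gamma] yields the relation between reciprocals.  Since
    [1 / alpha + 1 / beta] is thereby equal to [2 / gamma], it is nonzero, and
    inverting it gives the closed form for [gamma]. *)
Theorem mainTheorem7 (alpha beta gamma : R)
  (hbeta : beta <> 0)
  (harith : 2 * alpha = beta + gamma)
  (hgeom : beta ^ 2 = alpha * gamma) :
  gamma = harmonic_mean alpha beta /\ 2 / gamma = 1 / alpha + 1 / beta.
Proof.
  assert (hprod : alpha * gamma <> 0)
    by (rewrite <- hgeom; apply pow_nonzero, hbeta).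
  assert (halpha : alpha <> 0) by (intros h; apply hprod; rewrite h; ring).
  assert (hgamma : gamma <> 0) by (intros h; apply hprod; rewrite h; ring).
  assert (hcross : 2 * alpha * beta = gamma * (alpha + beta)).
  { rewrite harith.
    replace ((beta + gamma) * beta) with (beta ^ 2 + gamma * beta) by ring.
    rewrite hgeom; ring. }
  assert (hrecip : 2 / gamma = 1 / alpha + 1 / beta).
  { replace (2 / gamma) with (2 * alpha * beta / (alpha * beta * gamma))
      by (field; auto).
    rewrite hcross; field; auto. }
  split; [| exact hrecip].
  unfold harmonic_mean; rewrite <- hrecip; field; auto.
Qed.
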